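(* Let $J=[0,\infty)$ or $J=\mathbb R$, and let $H$ be an infinite dimensional Hilbert space. Then there exists $f\in EAP_0(J,H)$ such that neither the mean $m_B(|f|)$ nor the mean $m_B(|f|^2)$ exists, where $|f|(t)=\|f(t)\|$ and $|f|^2(t)=\|f(t)\|^2=(f(t),f(t))_H$. Consequently, neither $|f|$ nor $|f|^2$ belongs to $EAP(J,\mathbb C)$.
   Context: For a (real or complex) Banach space $X$ and $J\in\{[0,\infty),\mathbb R\}$, $C_b(J,X)$ denotes the Banach space of bounded continuous functions $f:J\to X$ with norm $\|f\|=\sup_{t\in J}\|f(t)\|$. For $s\in J$, $f_s(t):=f(s+t)$, $t\in J$, and the orbit of $f$ is $O(f):=\{f_s: s\in J\}$. $EAP(J,X)$ (Eberlein almost periodic functions) is the set of $f\in C_b(J,X)$ such that $O(f)$ is relatively weakly compact in $C_b(J,X)$. $EAP_0(J,X)$ is the set of $f\in EAP(J,X)$ such that $0$ belongs to the weak closure of $O(f)$ in $C_b(J,X)$. For a bounded continuous $g:J\to\mathbb R$ the mean is $m_B(g):=\lim_{T\to\infty}\frac1T\int_0^T g(t)\,dt$ if $J=[0,\infty)$, and $m_B(g):=\lim_{T\to\infty}\frac1{2T}\int_{-T}^T g(t)\,dt$ if $J=\mathbb R$; it is said to exist if this limit exists. *)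

(* Defs.v *)
From HB Require Import structures.
From mathcomp Require Import all_boot all_order all_algebra.
From mathcomp Require Import complex.
From mathcomp Require Import all_classical all_reals all_analysis.

Set Implicit Arguments.
Unset Strict Implicit.
Unset Printing Implicit Defensive.

Import Order.TTheory GRing.Theory Num.Theory.
Import numFieldNormedType.Exports.

Local Open Scope classical_set_scope.
Local Open Scope ring_scope.

Variant scalar_kind := RealScalars | ComplexScalars.

Definition scalar_field (R : realType) (c : scalar_kind) : numFieldType :=
  match c with RealScalars => R | ComplexScalars => R[i] end.

Section scalar_theory.
Variables (R : realType) (c : scalar_kind).
Local Notation K := (scalar_field R c).

Definition scalar_re : K -> R :=
  match c return scalar_field R c -> R with
  | RealScalars => fun x => x
  | ComplexScalars => fun x : R[i] => complex.Re x
  end.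

Definition of_real : R -> K :=
  match c return R -> scalar_field R c with
  | RealScalars => fun x => x
  | ComplexScalars => fun x => (x%:C)%C
  end.

Definition scalar_conj : K -> K :=
  match c return scalar_field R c -> scalar_field R c with
  | RealScalars => fun x => x
  | ComplexScalars => fun x : R[i] => x^*
  end.

End scalar_theory.
Arguments scalar_field : simpl never.
Arguments of_real {R} c.

Section scalar_lemmas.
Variables (R : realType) (c : scalar_kind).
Local Notation K := (scalar_field R c).
Implicit Types (x y : R) (k l : K).

Lemma of_realK : cancel (of_real c) (@scalar_re R c).
Proof. by case: c. Qed.

Lemma ler_of_real x y : (of_real c x <= of_real c y) = (x <= y).
Proof. by case: c => //=; rewrite lecR. Qed.

Lemma of_realD x y : of_real c (x + y) = of_real c x + of_real c y.
Proof. by case: c => //=; rewrite rmorphD. Qed.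

Lemma of_realM x y : of_real c (x * y) = of_real c x * of_real c y.
Proof. by case: c => //=; rewrite rmorphM. Qed.

Lemma of_real0 : of_real c (0 : R) = 0.
Proof. by case: c. Qed.

Lemma scalar_reK k : 0 <= k -> of_real c (scalar_re k) = k.
Proof.
case: c k => //= -[a b]; rewrite lecE /= => /andP[/eqP -> _]; by [].
Qed.

Lemma of_realB x y : of_real c (x - y) = of_real c x - of_real c y.
Proof. by case: c => //=; rewrite rmorphB. Qed.

Lemma norm_of_real x : `|of_real c x| = of_real c `|x|.
Proof.
by case: c => //=; rewrite normc_def/= expr0n addr0 sqrtr_sqr.
Qed.

End scalar_lemmas.

Section real_norm.
Variables (R : realType) (c : scalar_kind).
Variable V : normedModType (scalar_field R c).
Implicit Types (u v : V).

(* The library norm of a normed module over K takes its values in K. *)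
Definition rnorm v : R := scalar_re `|v|.

Lemma rnormE v : of_real c (rnorm v) = `|v|.
Proof. exact: scalar_reK. Qed.

Lemma rnorm_ge0 v : 0 <= rnorm v.
Proof. by rewrite -(ler_of_real c) rnormE of_real0. Qed.

Lemma rnorm_eq0 v : rnorm v = 0 -> v = 0.
Proof.
by move=> v0; apply/eqP; rewrite -normr_eq0 -rnormE v0 of_real0.
Qed.

Lemma rnorm0 : rnorm 0 = 0.
Proof. by rewrite /rnorm normr0; case: (c). Qed.

Lemma rnormN v : rnorm (- v) = rnorm v.
Proof. by rewrite /rnorm normrN. Qed.

Lemma rnormD u v : rnorm (u + v) <= rnorm u + rnorm v.
Proof. by rewrite -(ler_of_real c) of_realD !rnormE ler_normD. Qed.

Lemma rnormZ (k : scalar_field R c) v :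
  rnorm (k *: v) = scalar_re `|k| * rnorm v.
Proof.
apply: (can_inj (@of_realK R c)).
by rewrite of_realM !rnormE scalar_reK// normrZ.
Qed.

Lemma rnorm_dist u v : `|rnorm u - rnorm v| <= rnorm (u - v).
Proof.
rewrite ler_norml; apply/andP; split.
  rewrite lerNl opprB lerBlDr -(rnormN (u - v)) opprB.
  by rewrite -{1}(subrK u v) rnormD.
by rewrite lerBlDr -{1}(subrK v u) rnormD.
Qed.

Lemma rnorm_continuous : continuous rnorm.
Proof.
move=> v; apply/cvgrPdist_le => e e0.
have E0 : 0 < of_real c e.
  rewrite lt_neqAle -of_real0 ler_of_real.
  by rewrite (inj_eq (can_inj (@of_realK R c))) -lt_neqAle.
have /cvgrPdist_le/(_ _ E0) : id u @[u --> v] --> v by exact: cvg_id.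
apply: filterS => u /= uv; apply: le_trans (rnorm_dist _ _) _.
by rewrite -(ler_of_real c) rnormE.
Qed.

End real_norm.

Lemma of_real_continuous (R : realType) (c : scalar_kind) :
  continuous (of_real c : R -> (scalar_field R c)^o).
Proof.
move=> x; apply/cvgrPdist_le => e e0.
have e0' : 0 < scalar_re e.
  rewrite lt_neqAle -(ler_of_real c) scalar_reK ?(ltW e0)// of_real0.
  rewrite ltW// andbT.
  rewrite -(inj_eq (can_inj (@of_realK R c))) scalar_reK ?(ltW e0)//.
  by rewrite of_real0 lt_eqF.
have /cvgrPdist_le/(_ _ e0') : id y @[y --> x] --> x by exact: cvg_id.
apply: filterS => y /=; rewrite -(ler_of_real c) scalar_reK ?(ltW e0)//.
by rewrite -norm_of_real of_realB.
Qed.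

Section bounded_continuous.
Variables (R : realType) (c : scalar_kind).
Variables (T : topologicalType) (V : normedModType (scalar_field R c)).
Local Notation K := (scalar_field R c).

Definition is_Cb : {pred T -> V} :=
  mem [set f : T -> V | continuous f /\ bounded_fun f].

Record Cb := MkCb { Cb_fun :> T -> V ; Cb_funP : Cb_fun \in is_Cb }.

HB.instance Definition _ := [isSub for Cb_fun].
HB.instance Definition _ := [Choice of Cb by <:].

Lemma is_CbP (f : T -> V) :
  f \in is_Cb <-> continuous f /\ exists M : R, forall t, rnorm (f t) <= M.
Proof.
rewrite /is_Cb; split => [/set_mem[cf [M [Mr bf]]]|[cf [M fM]]].
  split=> //; exists (scalar_re (M + 1)) => t.
  have := bf (M + 1); rewrite ltrDl ltr01 => /(_ isT t I) ftM.
  rewrite -(ler_of_real c) rnormE scalar_reK//; exact: le_trans ftM.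
apply/mem_set; split => //; exists (of_real c M); split.
  by rewrite realE; case: (lerP 0 M) => [?|/ltW ?];
    rewrite -of_real0 !ler_of_real; apply/orP; [left|right].
by move=> x Mx t _; rewrite /= -rnormE (le_trans _ (ltW Mx))// ler_of_real.
Qed.

Lemma is_Cb_submod : submod_closed is_Cb.
Proof.
split.
  by apply/is_CbP; split; [exact: cst_continuous|exists 0 => t; rewrite rnorm0].
move=> k f g /is_CbP[cf [M fM]] /is_CbP[cg [N gN]]; apply/is_CbP; split.
  by move=> t; apply: cvgD; [apply: cvgZl_tmp; exact: cf|exact: cg].
exists (scalar_re `|k| * M + N) => t.
apply: le_trans (rnormD _ _) _; rewrite rnormZ lerD// ler_wpM2l//.
by rewrite -(ler_of_real c) scalar_reK// of_real0.
Qed.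

HB.instance Definition _ := GRing.isSubmodClosed.Build _ _ is_Cb is_Cb_submod.
HB.instance Definition _ := [SubChoice_isSubLmodule of Cb by <:].

Definition sup_norm (f : Cb) : R := sup [set rnorm (f t) | t in setT].

Lemma sup_norm_ub (f : Cb) t : rnorm (f t) <= sup_norm f.
Proof.
apply: ub_le_sup; last by exists t.
have /is_CbP[_ [M fM]] := Cb_funP f.
by exists M => _ [u _ <-].
Qed.

Lemma sup_norm_ge0 (f : Cb) : 0 <= sup_norm f.
Proof.
case: (pselect (exists t : T, True)) => [[t _]|nT].
  exact: le_trans (rnorm_ge0 _) (sup_norm_ub f t).
rewrite /sup_norm (_ : [set _ | _ in _] = set0) ?sup0//.
by rewrite -subset0 => r [t _ _]; apply: nT; exists t.
Qed.

Lemma sup_norm_le (f : Cb) (M : R) :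
  0 <= M -> (forall t, rnorm (f t) <= M) -> sup_norm f <= M.
Proof.
move=> M0 fM; case: (pselect (exists t : T, True)) => [[t _]|nT].
  by apply: ge_sup; [exists (rnorm (f t)); exists t|move=> _ [u _ <-]].
rewrite /sup_norm (_ : [set _ | _ in _] = set0) ?sup0//.
by rewrite -subset0 => r [t _ _]; apply: nT; exists t.
Qed.

Definition Cb_norm (f : Cb) : K := of_real c (sup_norm f).

Lemma Cb_normD f g : Cb_norm (f + g) <= Cb_norm f + Cb_norm g.
Proof.
rewrite /Cb_norm -of_realD ler_of_real sup_norm_le ?addr_ge0 ?sup_norm_ge0//.
by move=> t; rewrite (le_trans (rnormD _ _))// lerD// sup_norm_ub.
Qed.

Lemma Cb_normZ k f : Cb_norm (k *: f) = `|k| * Cb_norm f.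
Proof.
have k0 : 0 <= scalar_re `|k| by rewrite -(ler_of_real c) scalar_reK// of_real0.
have le_normZ l g : sup_norm (l *: g) <= scalar_re `|l| * sup_norm g.
  have l0 : 0 <= scalar_re `|l|.
    by rewrite -(ler_of_real c) scalar_reK// of_real0.
  apply: sup_norm_le; first by rewrite mulr_ge0 ?sup_norm_ge0.
  by move=> t; rewrite rnormZ ler_wpM2l// sup_norm_ub.
rewrite /Cb_norm -[X in X * _]scalar_reK// -of_realM; congr of_real.
apply/eqP; rewrite eq_le le_normZ/=.
have [->|k_neq0] := eqVneq k 0.
  rewrite normr0 (_ : scalar_re 0 = 0) ?mul0r ?sup_norm_ge0//.
  by rewrite -{1}(of_real0 R c) of_realK.
have k_gt0 : 0 < scalar_re `|k|.
  rewrite lt_neqAle k0 andbT; apply/eqP => E.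
  by move: k_neq0; rewrite -normr_eq0 -[`|k|]scalar_reK// -E of_real0 eqxx.
rewrite -ler_pdivlMl// -{1}(scalerK k_neq0 f) (le_trans (le_normZ _ _))//.
rewrite ler_wpM2r ?sup_norm_ge0// -(ler_of_real c) scalar_reK// normfV.
suff -> : of_real c (scalar_re `|k|)^-1 = `|k|^-1 by [].
have nk0 : `|k| != 0 by rewrite normr_eq0.
apply: (mulfI nk0); rewrite divff// -{1}[`|k|]scalar_reK// -of_realM.
rewrite divff ?gt_eqF//; by case: (c).
Qed.

Lemma Cb_norm_eq0 f : Cb_norm f = 0 -> f = 0.
Proof.
rewrite /Cb_norm -(of_real0 R c) => /(can_inj (@of_realK R c)) f0.
apply/val_inj/funext => t /=; apply: rnorm_eq0; apply/eqP.
by rewrite eq_le rnorm_ge0 -f0 sup_norm_ub.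
Qed.

HB.instance Definition _ :=
  @Lmodule_isNormed.Build K Cb Cb_norm Cb_normD Cb_normZ Cb_norm_eq0.

End bounded_continuous.
Arguments is_Cb {R c} T V _.

Section weak_topo.
Variables (R : realType) (c : scalar_kind).
Variable V : normedModType (scalar_field R c).

Definition continuous_dual :=
  {phi : {linear V -> (scalar_field R c)^o} | continuous phi}.

Definition weak_space : topologicalType :=
  sup_topology (fun phi : continuous_dual =>
    Topological.on (initial_topology (sval phi : V -> (scalar_field R c)^o))).

Definition weakly_relatively_compact (A : set V) : Prop :=
  precompact (A : set weak_space).

Definition weak_closure (A : set V) : set V := closure (A : set weak_space).

End weak_topo.

Definition infinite_dimensional (K : numFieldType) (V : lmodType K) : Prop :=
  ~ exists (n : nat) (e : 'I_n -> V),
      forall v, exists a : 'I_n -> K, v = \sum_i a i *: e i.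

Variant time_domain := HalfLine | FullLine.

Definition time_set (R : realType) (J : time_domain) : set R :=
  match J with HalfLine => `[0, +oo[ | FullLine => setT end.

Arguments time_set : clear implicits.

Definition time (R : realType) (J : time_domain) : topologicalType :=
  set_type (time_set R J).

Section translation.
Variables (R : realType) (J : time_domain).
Local Notation T := (time R J).

Lemma time_addP (s t : T) : set_val s + set_val t \in time_set R J.
Proof.
apply/mem_set; case: J s t => //= s t.
have /set_mem := valP s; have /set_mem := valP t.
rewrite /= !in_itv/= !andbT => t0 s0; exact: addr_ge0.
Qed.

Definition time_add (s t : T) : T := SigSub (time_addP s t).

Lemma time_add_continuous (s : T) : continuous (time_add s).
Proof.
apply: (@continuous_comp_initial _ _ R set_val) => t.
apply: (@continuous_comp _ R R set_val (fun x => set_val s + x)).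
  exact: (@initial_continuous _ R set_val).
by apply: cvgD; [exact: cvg_cst|exact: cvg_id].
Qed.

Variables (c : scalar_kind) (V : normedModType (scalar_field R c)).

Lemma translateP (s : T) (f : Cb T V) :
  (fun t => f (time_add s t)) \in is_Cb T V.
Proof.
have /is_CbP[cf [M fM]] := Cb_funP f; apply/is_CbP; split; last by exists M.
move=> t; apply: (@continuous_comp _ _ _ (time_add s) f).
  exact: time_add_continuous.
exact: cf.
Qed.

Definition translate (s : T) (f : Cb T V) : Cb T V := MkCb (translateP s f).

Definition translation_orbit (f : Cb T V) : set (Cb T V) :=
  [set translate s f | s in setT].

End translation.

Section eberlein.
Variables (R : realType) (J : time_domain).
Variables (c : scalar_kind) (V : normedModType (scalar_field R c)).

Definition EAP : set (Cb (time R J) V) :=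
  [set f | weakly_relatively_compact (translation_orbit f)].

Definition EAP0 : set (Cb (time R J) V) :=
  [set f | EAP f /\ weak_closure (translation_orbit f) 0].

End eberlein.

Section mean.
Variables (R : realType) (J : time_domain).

(* [oapp g 0 (insub t)] is [g] at the real [t], and 0 off the domain; the
   integrals below only see points of the domain. *)
Definition average (g : time R J -> R) (T : R) : R :=
  let mu := @lebesgue_measure R in
  match J with
  | HalfLine => T^-1 * \int[mu]_(t in `[0, T]) oapp g 0 (insub t)
  | FullLine => (2 * T)^-1 * \int[mu]_(t in `[- T, T]) oapp g 0 (insub t)
  end.

Definition mean_exists (g : time R J -> R) : Prop :=
  cvg (average g T @[T --> +oo]).

End mean.

Section norm_functions.
Variables (R : realType) (J : time_domain).
Variables (c : scalar_kind) (V : normedModType (scalar_field R c)).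
Local Notation C := ((scalar_field R ComplexScalars)^o).

Definition norm_fun (f : Cb (time R J) V) (t : time R J) : R := rnorm (f t).

Definition sqnorm_fun (f : Cb (time R J) V) (t : time R J) : R :=
  rnorm (f t) ^+ 2.

Definition complexify (g : time R J -> R) (t : time R J) : C :=
  of_real ComplexScalars (g t).

Lemma complexifyP (g : time R J -> R) (M : R) :
  continuous g -> (forall t, `|g t| <= M) ->
  complexify g \in is_Cb (time R J) C.
Proof.
move=> cg gM; apply/is_CbP; split.
  move=> t; apply: (@continuous_comp _ _ _ g (of_real ComplexScalars)).
    exact: cg.
  exact: of_real_continuous.
exists M => t; rewrite /rnorm norm_of_real of_realK; exact: gM.
Qed.

Lemma norm_fun_continuous (f : Cb (time R J) V) : continuous (norm_fun f).
Proof.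
have /is_CbP[cf _] := Cb_funP f.
move=> t; apply: (@continuous_comp _ _ _ f (@rnorm R c V)); first exact: cf.
exact: rnorm_continuous.
Qed.

Lemma norm_CbP (f : Cb (time R J) V) :
  complexify (norm_fun f) \in is_Cb (time R J) C.
Proof.
apply: (complexifyP (M := sup_norm f)); first exact: norm_fun_continuous.
by move=> t; rewrite ger0_norm ?rnorm_ge0// sup_norm_ub.
Qed.

Lemma sqnorm_CbP (f : Cb (time R J) V) :
  complexify (sqnorm_fun f) \in is_Cb (time R J) C.
Proof.
apply: (complexifyP (M := sup_norm f ^+ 2)).
  by move=> t; apply: (@continuousM _ _ (norm_fun f) (norm_fun f));
    exact: norm_fun_continuous.
move=> t; rewrite ger0_norm ?sqr_ge0//.
by rewrite lerXn2r ?nnegrE ?rnorm_ge0 ?sup_norm_ge0 ?sup_norm_ub.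
Qed.

Definition norm_Cb f : Cb (time R J) C := MkCb (norm_CbP f).
Definition sqnorm_Cb f : Cb (time R J) C := MkCb (sqnorm_CbP f).

End norm_functions.

(* Main.v *)
(** With (e_n) an orthonormal sequence of H, let
      f(t) = sin(pi t)^2 e_n  for n <= t < n + 1
    when n lies in a block 4^m <= n < 2 * 4^m, and f(t) = 0 otherwise.
    Translates of f by amounts at distance at least 1 are pointwise orthogonal,
    so a sum of N of them, with unimodular coefficients, has sup norm at most
    sqrt N. Hence f_s tends weakly to 0 as |s| tends to infinity; as s |-> f_s
    is continuous in norm, {f_s} together with 0 is a weakly compact set.

    The averages of |f| and |f|^2 over [0, T] oscillate, since the blocks and
    the gaps between them have lengths comparable to their distance from 0. At
    s_n + t_m, where s_n = 2 * 4^n and t_m = 4^m + 1/2, the functions |f| and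
    |f|^2 take the value 0 if m <= n and 1 if m > n, so their iterated limits
    differ, which weak relative compactness of the orbits would forbid. *)
Require Import Defs.
From HB Require Import structures.
From mathcomp Require Import all_boot all_order all_algebra.
From mathcomp Require Import complex.
From mathcomp Require Import all_classical all_reals all_analysis.
From mathcomp Require Import zify ring lra.

Set Implicit Arguments.
Unset Strict Implicit.
Unset Printing Implicit Defensive.

Import Order.TTheory GRing.Theory Num.Theory.
Import numFieldNormedType.Exports.

Local Open Scope classical_set_scope.
Local Open Scope ring_scope.

(** * The embedding of the reals in the scalar field *)

Section scalars.
Variables (R : realType) (c : scalar_kind).
Local Notation K := (scalar_field R c).

Lemma of_real1 : of_real c (1 : R) = 1.
Proof. by case: c. Qed.

Lemma of_real_sum (I : Type) (r : seq I) (P : pred I) (F : I -> R) :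
  of_real c (\sum_(i <- r | P i) F i) = \sum_(i <- r | P i) of_real c (F i).
Proof. by apply: big_morph; [exact: of_realD|exact: of_real0]. Qed.

Lemma ltr_of_real (x y : R) : (of_real c x < of_real c y) = (x < y).
Proof.
by rewrite !lt_neqAle ler_of_real (inj_eq (can_inj (@of_realK R c))).
Qed.

Lemma scalar_re_gt0 (k : K) : 0 < k -> 0 < scalar_re k.
Proof.
by move=> k0; rewrite -(ltr_of_real 0) of_real0 scalar_reK// ltW.
Qed.

End scalars.

(** * The weak topology and bounded functionals *)

Section weak_topology.
Variables (R : realType) (c : scalar_kind).
Variable V : normedModType (scalar_field R c).
Local Notation K := (scalar_field R c).

Lemma weak_functional_continuous (phi : continuous_dual V) :
  continuous (sval phi : weak_space V -> K^o).
Proof.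
move=> v.
have /cvg_sup/(_ phi) vphi : nbhs (v : weak_space V) --> (v : weak_space V).
  exact: cvg_id.
apply: cvg_comp; first exact: vphi.
exact: (@initial_continuous V K^o (sval phi)).
Qed.

(** The weak topology is the supremum of the initial topologies of the functionals, so convergence
    can be tested on each of them. *)
Lemma weak_cvg (F : set_system V) (v : V) : Filter F ->
  (forall phi : continuous_dual V, sval phi @ F --> (sval phi v : K^o)) ->
  F --> (v : weak_space V).
Proof.
move=> FF Fphi; apply/cvg_sup => phi A /=.
rewrite (@nbhsE (initial_topology (sval phi : V -> K^o))).
move=> [_ [[B oB <-] Bv] BA].
exact: filterS BA (Fphi phi B (open_nbhs_nbhs (conj oB Bv))).
Qed.

Lemma continuous_dual_bound (phi : continuous_dual V) :
  exists2 M : R, 0 < M & forall v, rnorm (sval phi v : K^o) <= M * rnorm v.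
Proof.
have /linear_bounded_continuous/linear_boundedP/pinfty_ex_gt0[M M0 phiM] :=
  svalP phi.
exists (scalar_re M); first exact: scalar_re_gt0.
move=> v; rewrite -(ler_of_real c) of_realM !rnormE scalar_reK ?(ltW M0)//.
Qed.

Lemma continuous_dual_exists (phi : V -> K^o) (M : R) :
  linear phi -> (forall v, rnorm (phi v) <= M * rnorm v) ->
  exists psi : continuous_dual V, sval psi =1 phi.
Proof.
move=> lphi phiM.
pose lin := GRing.isLinear.Build K V K^o *:%R phi lphi.
pose psi : {linear V -> K^o} := HB.pack phi lin.
suff cpsi : continuous psi by exists (exist _ psi cpsi).
apply/linear_bounded_continuous/linear_boundedP.
exists (of_real c `|M|); split; first by rewrite -norm_of_real normr_real.
move=> r Mr v; apply: (@le_trans _ _ (of_real c `|M| * `|v|)); last first.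
  by rewrite ler_wpM2r// ltW.
rewrite -(rnormE (psi v)) -(rnormE v) -of_realM ler_of_real.
by rewrite (le_trans (phiM v))// ler_wpM2r ?rnorm_ge0// ler_norm.
Qed.

End weak_topology.

(** * Inner products, Cauchy-Schwarz and orthonormal sequences *)

Section inner_product.
Variables (R : realType) (c : scalar_kind).
Local Notation K := (scalar_field R c).
Variables (H : normedModType K) (ip : {dot H for @scalar_conj R c}).
Hypothesis ip_norm : forall x : H, `|x| ^+ 2 = ip x x.
Implicit Types (u v : H).

Lemma ip_orthC u v : ip u v = 0 -> ip v u = 0.
Proof.
have -> : ip v u = (-1) ^+ false * @scalar_conj R c (ip u v).
  exact: hermitian_subproof.
move=> ->; rewrite expr0 mul1r.
by case: (c) => //=; rewrite conjC0.
Qed.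

Lemma rnorm_sqrE u : of_real c (rnorm u ^+ 2) = ip u u.
Proof. by rewrite expr2 of_realM rnormE -expr2 ip_norm. Qed.

Lemma pythagoras u v : ip u v = 0 ->
  rnorm (u + v) ^+ 2 = rnorm u ^+ 2 + rnorm v ^+ 2.
Proof.
move=> uv; apply: (can_inj (@of_realK R c)).
rewrite of_realD !rnorm_sqrE linearDl !linearDr/= uv (ip_orthC uv).
by rewrite addr0 add0r.
Qed.

Lemma rnorm_sum_orthogonal (x : nat -> H) (N : nat) :
  (forall i j, i != j -> ip (x i) (x j) = 0) ->
  (forall i, rnorm (x i) <= 1) ->
  rnorm (\sum_(i < N) x i) ^+ 2 <= N%:R.
Proof.
move=> xo x1; elim: N => [|N IH]; first by rewrite big_ord0 rnorm0 expr0n.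
rewrite big_ord_recr/= pythagoras; last first.
  by rewrite linear_sumlz/= big1// => i _; rewrite xo// ltn_eqF.
by rewrite -natr1 lerD// expr_le1// rnorm_ge0.
Qed.

(** The projection [k *: v] of [u] onto [v] is no longer than [u] by Pythagoras, and [ip u v] equals
    [k * ip v v]. *)
Lemma cauchy_schwarz u v : rnorm (ip u v : K^o) <= rnorm v * rnorm u.
Proof.
have [->|v0] := eqVneq v 0; first by rewrite linear0r !rnorm0 mul0r.
have vv0 : ip v v != 0 by rewrite -ip_norm expf_neq0// normr_eq0.
pose k := ip u v / ip v v.
have ort : ip (u - k *: v) (k *: v) = 0.
  have uv : ip (u - k *: v) v = 0.
    by rewrite linearBl linearZl_LR/= /k divfK ?subrr.
  by apply: ip_orthC; rewrite linearZl_LR/= (ip_orthC uv) mulr0.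
have kv : rnorm (k *: v) <= rnorm u.
  rewrite -(@ler_pXn2r _ 2)// ?nnegrE ?rnorm_ge0//.
  rewrite -[in leRHS](subrK (k *: v) u).
  by rewrite (pythagoras ort) lerDr sqr_ge0.
have E : rnorm (ip u v : K^o) = rnorm v * rnorm (k *: v).
  rewrite -{1}(divfK vv0 (ip u v)) -/k -ip_norm.
  apply: (can_inj (@of_realK R c)).
  rewrite rnormE normrM normrX normr_id of_realM !rnormE.
  by rewrite expr2 mulrCA (normrZ k v) [`|k|]normrM.
by rewrite E ler_wpM2l ?rnorm_ge0.
Qed.

(** If no such unit vector existed, every [v] would equal its projection onto the span of [s]: a
    nonzero remainder [w], once normalised, would be one. Then [s] would be a finite spanning
    family. *)
Lemma orthonormal_extension (s : seq H) : infinite_dimensional H ->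
  all (fun u => `|u| == 1) s -> pairwise (fun u v => ip u v == 0) s ->
  exists2 u, `|u| = 1 & all (fun v => ip v u == 0) s.
Proof.
move=> Hinf s1 so; apply: contrapT => nou; apply: Hinf.
have sii (i j : 'I_(size s)) : ip s`_i s`_j = (i == j)%:R.
  have [<-|ij] := eqVneq.
    by rewrite -ip_norm (eqP (all_nthP 0 s1 i _))// expr1n.
  have lt (a b : 'I_(size s)) : (a < b)%N -> ip s`_a s`_b = 0.
    by move=> ab; apply/eqP; apply: (pairwiseP 0 so) => //; rewrite inE.
  case: (ltngtP i j) => [/lt//|/lt/ip_orthC//|/val_inj/eqP].
  by rewrite (negbTE ij).
exists (size s), (fun i => s`_i) => v.
exists (fun i => ip v s`_i).
apply/eqP; rewrite -subr_eq0; apply: contrapT => /negP w0.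
set w := v - _ in w0.
apply: nou; exists (`|w|^-1 *: w).
  by rewrite normrZ normfV normr_id mulVf ?normr_eq0.
apply/(all_nthP 0) => i ltis; apply/eqP; apply: ip_orthC.
have wi : ip w s`_i = 0.
  rewrite /w linearBl/= linear_sumlz/= (bigD1 (Ordinal ltis))//= big1 ?addr0.
    rewrite linearZl_LR/= (sii (Ordinal ltis) (Ordinal ltis)) eqxx mulr1.
    by rewrite subrr.
  move=> j jn; rewrite linearZl_LR/= (sii j (Ordinal ltis)).
  by rewrite (negbTE jn) mulr0.
by rewrite linearZl_LR/= wi mulr0.
Qed.

Lemma orthonormal_sequence : infinite_dimensional H ->
  exists e : nat -> H, (forall n, `|e n| = 1) /\
    forall m n, m != n -> ip (e m) (e n) = 0.
Proof.
move=> Hinf.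
pose good s :=
  all (fun u => `|u| == 1) s && pairwise (fun u v => ip u v == 0) s.
have /choice[next nextP] : forall s : seq H, exists u, good s ->
    `|u| = 1 /\ all (fun v => ip v u == 0) s.
  move=> s; case/boolP: (good s) => [/andP[s1 so]|_]; last by exists 0.
  by have [u u1 us] := orthonormal_extension Hinf s1 so; exists u.
(* [L n] lists the first [n] vectors of the sequence. [next] is defined on all lists, but
   constrained only on those satisfying [good], as every [L n] does. *)
pose L := fix L n := if n is n'.+1 then rcons (L n') (next (L n')) else [::].
have goodL n : good (L n).
  elim: n => [//|n IH]; have [u1 us] := nextP _ IH.
  rewrite /good/= all_rcons pairwise_rcons u1 eqxx us/=.
  exact: IH.
have memL m n : (m < n)%N -> next (L m) \in L n.
  elim: n => // n IH; rewrite ltnS leq_eqVlt => /predU1P[->|/IH mn] /=.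
    by rewrite mem_rcons mem_head.
  by rewrite mem_rcons inE mn orbT.
exists (fun n => next (L n)); split=> [n|m n mn].
  by have [] := nextP _ (goodL n).
have lt a b : (a < b)%N -> ip (next (L a)) (next (L b)) = 0.
  by move=> /memL ab; have [_ /allP/(_ _ ab)/eqP] := nextP _ (goodL b).
by case: (ltngtP m n) mn => // [/lt//|/lt/ip_orthC].
Qed.

End inner_product.

(** * Weakly null families and weak compactness *)

Section weakly_null_translates.
Variables (R : realType) (c : scalar_kind).
Local Notation K := (scalar_field R c).

Lemma rnorm_Cb (T : topologicalType) (V : normedModType K) (u : Cb T V) :
  rnorm u = sup_norm u.
Proof. exact: of_realK. Qed.

Lemma rnorm_Cb_ub (T : topologicalType) (V : normedModType K) (u : Cb T V) t :
  rnorm (u t) <= rnorm u.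
Proof. by rewrite rnorm_Cb sup_norm_ub. Qed.

Lemma phase_exists (k : K) : exists2 a : K, `|a| = 1 & a * k = `|k|.
Proof.
have [->|k0] := eqVneq k 0; first by exists 1; rewrite ?normr1// mulr0 normr0.
exists (`|k| / k); last by rewrite divfK.
by rewrite normrM normfV normr_id divff// normr_eq0.
Qed.

Lemma Cb_sumE (T : topologicalType) (V : normedModType K) (I : Type)
    (r : seq I) (P : pred I) (u : I -> Cb T V) t :
  (\sum_(i <- r | P i) u i) t = \sum_(i <- r | P i) u i t.
Proof. by elim/big_rec2 : _ => // i x y _ <-. Qed.

Variables (T : topologicalType) (H : normedModType K).
Variable ip : {dot H for @scalar_conj R c}.
Hypothesis ip_norm : forall x : H, `|x| ^+ 2 = ip x x.

(* If [phi (Phi s)] stayed large, then N mutually orthogonal translates,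
   rotated so that their images under [phi] add up, would give an element of
   norm at most [sqrt N] on which [phi] is at least [eps * N]. *)
Lemma orthogonal_family_weakly_null (Phi : R -> Cb T H) :
  (forall s r t, 1 <= `|s - r| -> ip (Phi s t) (Phi r t) = 0) ->
  (forall s t, rnorm (Phi s t) <= 1) ->
  forall (phi : continuous_dual (Cb T H)) (eps : R), 0 < eps ->
  exists M : R, forall s, M <= `|s| -> rnorm (sval phi (Phi s) : K^o) < eps.
Proof.
move=> Phio Phi1 phi eps eps0; apply: contrapT => noM.
have /choice[next nextP] : forall M : R, exists s, M <= `|s| /\
    eps <= rnorm (sval phi (Phi s) : K^o).
  move=> M; apply: contrapT => nos; apply: noM; exists M => s Ms.
  by rewrite ltNge; apply/negP => phis; apply: nos; exists s.
(* Each point exceeds the previous one in modulus by at least 1, so by the reverse triangle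
   inequality any two are at distance at least 1. *)
pose s := fix s n := if n is n'.+1 then next (`|s n'| + 1) else next 0.
have s_eps n : eps <= rnorm (sval phi (Phi (s n)) : K^o).
  by case: n => [|n] /=; apply: (nextP _).2.
have sS n : `|s n| + 1 <= `|s n.+1| by apply: (nextP _).1.
have s_lt m n : (m < n)%N -> `|s m| + 1 <= `|s n|.
  elim: n => // n IH; rewrite ltnS leq_eqVlt => /predU1P[->//|/IH mn].
  by apply: le_trans mn (le_trans _ (sS n)); rewrite lerDl.
have sep m n : m != n -> 1 <= `|s m - s n|.
  have lt a b : (a < b)%N -> 1 <= `|s a - s b|.
    move=> /s_lt ab; rewrite distrC; apply: le_trans (lerB_dist _ _).
    by rewrite lerBrDl.
  by case: (ltngtP m n) => // [/lt//|/lt]; rewrite distrC.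
have /choice[a aP] : forall n, exists a : K,
    `|a| = 1 /\ a * sval phi (Phi (s n)) = `|sval phi (Phi (s n)) : K^o|.
  by move=> n; have [b b1 bk] := phase_exists (sval phi (Phi (s n))); exists b.
pose v N : Cb T H := \sum_(i < N) a i *: Phi (s i).
have vN N : rnorm (v N) ^+ 2 <= N%:R.
  rewrite -[leRHS]sqr_sqrtr ?ler0n// ler_pXn2r ?nnegrE ?rnorm_ge0 ?sqrtr_ge0//.
  rewrite rnorm_Cb sup_norm_le ?sqrtr_ge0// => t.
  rewrite -(@ler_pXn2r _ 2)// ?nnegrE ?rnorm_ge0 ?sqrtr_ge0//.
  rewrite sqr_sqrtr ?ler0n// /v Cb_sumE.
  apply: (@rnorm_sum_orthogonal _ _ _ ip ip_norm
    (fun i => (a i *: Phi (s i)) t)).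
    move=> i j ij; rewrite /= linearZl_LR/= linearZr_LR/=.
    by rewrite Phio ?mulr0 ?sep// mulr0.
  move=> i /=; rewrite rnormZ (aP i).1.
  by rewrite -[X in scalar_re X](of_real1 R c) of_realK mul1r.
have phiv N : N%:R * eps <= rnorm (sval phi (v N) : K^o).
  have -> : sval phi (v N) =
      of_real c (\sum_(i < N) rnorm (sval phi (Phi (s i)) : K^o)).
    rewrite /v linear_sum of_real_sum; apply: eq_bigr => i _.
    by rewrite linearZ rnormE; exact: (aP i).2.
  rewrite [leRHS]/rnorm norm_of_real of_realK.
  rewrite ger0_norm; last by apply: sumr_ge0 => i _; exact: rnorm_ge0.
  rewrite -[N in N%:R]card_ord mulrC mulr_natr -sumr_const.
  by apply: ler_sum => i _; exact: s_eps.
have [M M0 phiM] := continuous_dual_bound phi.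
(* Squaring gives [N ^ 2 * eps ^ 2 <= M ^ 2 * N]; after cancelling one factor [N], a large [N]
   contradicts it. *)
have bound (N : nat) : N%:R * eps ^+ 2 <= M ^+ 2.
  case: N => [|N]; first by rewrite mul0r sqr_ge0.
  rewrite -(@ler_pM2l _ N.+1%:R) ?ltr0n// mulrA -expr2 -exprMn.
  apply: (@le_trans _ _ ((M * rnorm (v N.+1)) ^+ 2)).
    rewrite ler_pXn2r ?nnegrE ?mulr_ge0 ?ler0n ?rnorm_ge0 ?(ltW M0)//;
      last exact: ltW.
    exact: le_trans (phiv _) (phiM _).
  by rewrite exprMn mulrC ler_wpM2r ?sqr_ge0.
have := bound (Num.truncn (M ^+ 2 / eps ^+ 2)).+1.
rewrite -ler_pdivlMr ?exprn_gt0// leNgt => /negP; apply.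
exact: truncnS_gt.
Qed.

(** If [p] and [q] differ at [t], the functional pairing the value at [t] with [h = p t - q t]
    separates them: its values differ by [ip h h]. *)
Lemma weak_Cb_hausdorff : hausdorff_space (weak_space (Cb T H)).
Proof.
move=> p q pq; apply: contrapT => p_neq_q.
have [t ptqt] : exists t, p t <> q t.
  apply: contrapT => npq; apply: p_neq_q; apply/val_inj/funext => t.
  by apply: contrapT => ?; apply: npq; exists t.
pose h : H := p t - q t.
have [|u|psi psiE] := @continuous_dual_exists _ _ (Cb T H)
  (fun u => ip (u t) h : K^o) (rnorm h).
- by move=> k u v /=; rewrite linearDl linearZl_LR.
- apply: le_trans (cauchy_schwarz ip_norm _ _) _.
  by rewrite ler_wpM2l ?rnorm_ge0// rnorm_Cb_ub.
have psipq : sval psi p = sval psi q.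
  apply: (@norm_hausdorff _ K^o) => A B Ap Bq.
  have [u [Au Bu]] := pq _ _ (weak_functional_continuous Ap)
    (weak_functional_continuous Bq).
  by exists (sval psi u).
have hh : ip h h = 0.
  by move: psipq; rewrite !psiE /= => E; rewrite {1}/h linearBl/= E subrr.
apply: ptqt; apply/eqP; rewrite -subr_eq0 -/h -normr_eq0.
by have := ip_norm h; rewrite hh => /eqP; rewrite expf_eq0.
Qed.

(* The family extends continuously, for the weak topology, to the one-point
   compactification of the line by the value 0 at infinity. *)
Lemma weakly_null_family_precompact (Phi : R -> Cb T H) :
  continuous Phi ->
  (forall (phi : continuous_dual (Cb T H)) (eps : R), 0 < eps ->
    exists M : R, forall s, M <= `|s| ->
      rnorm (sval phi (Phi s) : K^o) < eps) ->
  weakly_relatively_compact (range Phi).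
Proof.
move=> cPhi Phi0.
pose S : set (weak_space (Cb T H)) := range Phi `|` [set 0].
apply: (@precompact_subset _ _ S); first exact: subsetUl.
apply: compact_precompact; first exact: weak_Cb_hausdorff.
have wPhi : continuous (Phi : R -> weak_space (Cb T H)).
  move=> s; apply: weak_cvg => phi.
  by apply: cvg_comp; [exact: cPhi|exact: (svalP phi)].
(* The filter expresses that [|s|] tends to infinity, in both directions at once. *)
have Phioo : Phi s @[s --> filter_from setT (fun M : R => [set s | M <= `|s|])]
    --> (0 : weak_space (Cb T H)).
  have fF : Filter (filter_from setT (fun M : R => [set s : R | M <= `|s|])).
    apply: filter_from_filter; first by exists 0.
    move=> M N _ _; exists (Num.max M N) => // s /=.
    by rewrite ge_max => /andP.
  apply: weak_cvg => phi; rewrite linear0.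
  apply/cvgrPdist_lt => e e0.
  have [M MP] := Phi0 phi _ (scalar_re_gt0 e0).
  exists M => // s /= /MP s_e; rewrite sub0r normrN -rnormE.
  by rewrite -(scalar_reK (ltW e0)) ltr_of_real.
move=> F FF FS.
(* If [F] does not cluster at 0, some [A] in [F] misses a neighbourhood [B] of 0. Since [B] contains
   [Phi s] once [M <= |s|], the trace of [A] on [S] lies in the image of a compact segment, where
   [F] must cluster. *)
have [cl0|] := pselect (cluster F (0 : weak_space (Cb T H))).
  by exists 0; split=> //; right.
move=> /existsNP[A /existsNP[B /not_implyP[FA /not_implyP[B0 AB]]]].
have [M _ MB] := Phioo _ B0.
have cI : compact ((Phi : R -> weak_space (Cb T H)) @` `[- `|M|, `|M|]).
  apply: continuous_compact; last exact: segment_compact.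
  exact: continuous_subspaceT.
have [|p [[s _ <-] clp]] := cI F FF.
  apply: filterS (filterI FA FS) => u [Au [[s _ su]|u0]]; last first.
    exfalso; apply: AB; exists u; split=> //; rewrite u0.
    exact: (@nbhs_singleton (weak_space (Cb T H))).
  exists s => //=; rewrite in_itv/= -ler_norml leNgt; apply/negP => Ms.
  apply: AB; exists u; split=> //; rewrite -su; apply: MB => /=.
  exact: le_trans (ler_norm _) (ltW Ms).
by exists (Phi s); split=> //; left; exists s.
Qed.

End weakly_null_translates.

(** * Limits of bounded real sequences along an ultrafilter *)

Section ultralimit.
Variables (R : realType) (U : set_system nat).
Hypothesis UU : UltraFilter U.

Lemma ultra_fmap (x : nat -> R) : UltraFilter (x @ U).
Proof.
have PU : ProperFilter U by exact: ultra_proper.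
apply: Build_UltraFilter => G PG xUG.
rewrite predeqE => A; split=> [GA|]; last exact: xUG.
have [//|UnA] := in_ultra_setVsetC (x @^-1` A) UU.
have GnA : G (~` A) by apply: xUG.
exfalso; apply: (@filter_not_empty _ G).
by rewrite -(setICr A); exact: filterI.
Qed.

Lemma bounded_ultralimit (x : nat -> R) (B : R) : (forall n, `|x n| <= B) ->
  cvg (x @ U) /\ `|lim (x @ U)| <= B.
Proof.
move=> xB; have UxU := ultra_fmap x.
have PU : ProperFilter U by exact: ultra_proper.
have := @segment_compact R (- B) B.
rewrite compact_ultra => /(_ _ UxU)[|l [lB xl]].
  by apply: (@filterE nat U) => n; rewrite /= in_itv/= -ler_norml.
split; first by apply/cvg_ex; exists l.
by rewrite (cvg_lim _ xl)//; move: lB; rewrite /= in_itv/= -ler_norml.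
Qed.

End ultralimit.

(** * The double limit criterion *)

Section double_limit.
Variables (R : realType) (J : time_domain).
Local Notation C := ((scalar_field R ComplexScalars)^o).
Local Notation T := (time R J).

Lemma rnorm_complexE (x : C) :
  rnorm x = Num.sqrt (complex.Re (x : R[i]) ^+ 2 + complex.Im (x : R[i]) ^+ 2).
Proof. exact: (congr1 (@complex.Re R) (normc_def (x : R[i]))). Qed.

Lemma Re_le_rnorm (x : C) : `|complex.Re (x : R[i])| <= rnorm x.
Proof. by rewrite rnorm_complexE -sqrtr_sqr ler_wsqrtr// lerDl sqr_ge0. Qed.

Lemma Im_le_rnorm (x : C) : `|complex.Im (x : R[i])| <= rnorm x.
Proof. by rewrite rnorm_complexE -sqrtr_sqr ler_wsqrtr// lerDr sqr_ge0. Qed.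

Lemma rnorm_le_ReIm (x : C) :
  rnorm x <= `|complex.Re (x : R[i])| + `|complex.Im (x : R[i])|.
Proof.
rewrite rnorm_complexE -[leRHS]ger0_norm ?addr_ge0// -sqrtr_sqr ler_wsqrtr//.
rewrite sqrrD !real_normK ?num_real// lerD2r lerDl.
by rewrite mulrn_wge0// mulr_ge0.
Qed.

(** The functional is the limit of [u (t n)] along an ultrafilter containing all cofinite sets. Real
    and imaginary parts are treated separately, each limit being at most [rnorm u]; hence the bound
    2. *)
Lemma sequential_limit_functional (t : nat -> T) :
  exists phi : continuous_dual (Cb T C), forall (u : Cb T C) (k : C),
    (\forall n \near \oo, u (t n) = k) -> sval phi u = k.
Proof.
have [U [UU Uoo]] := ultraFilterLemma eventually_filter.
have PU : ProperFilter U by exact: ultra_proper.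
pose re (u : Cb T C) n : R := complex.Re (u (t n) : R[i]).
pose im (u : Cb T C) n : R := complex.Im (u (t n) : R[i]).
have reP u : cvg (re u @ U) /\ `|lim (re u @ U)| <= rnorm u.
  apply: bounded_ultralimit => n.
  exact: le_trans (Re_le_rnorm _) (rnorm_Cb_ub _ _).
have imP u : cvg (im u @ U) /\ `|lim (im u @ U)| <= rnorm u.
  apply: bounded_ultralimit => n.
  exact: le_trans (Im_le_rnorm _) (rnorm_Cb_ub _ _).
pose phi (u : Cb T C) : C :=
  (Complex (lim (re u @ U)) (lim (im u @ U)) : R[i]).
have [|u|psi psiE] := @continuous_dual_exists _ _ (Cb T C) phi 2.
- move=> k u v; apply/eqP; rewrite /phi eq_complex/=.
  case: k => ka kb.
  have aff (x y : R[i]) :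
      complex.Re ((Complex ka kb) * x + y) =
        ka * complex.Re x - kb * complex.Im x + complex.Re y /\
      complex.Im ((Complex ka kb) * x + y) =
        ka * complex.Im x + kb * complex.Re x + complex.Im y.
    by case: x; case: y.
  have [[ru _] [iu _] [rv _] [iv _]] := And4 (reP u) (imP u) (reP v) (imP v).
  have -> : re ((Complex ka kb : scalar_field R ComplexScalars) *: u + v) =
      (fun n => ka * re u n - kb * im u n + re v n).
    by apply/funext => n; exact: (aff (u (t n)) (v (t n))).1.
  have -> : im ((Complex ka kb : scalar_field R ComplexScalars) *: u + v) =
      (fun n => ka * im u n + kb * re u n + im v n).
    by apply/funext => n; exact: (aff (u (t n)) (v (t n))).2.
  apply/andP; split; apply/eqP; apply: cvg_lim => //.
    by apply: cvgD rv; apply: cvgB; apply: cvgMr.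
  by apply: cvgD iv; apply: cvgD; apply: cvgMr.
- apply: le_trans (rnorm_le_ReIm _) _.
  by rewrite mulr_natl mulr2n lerD//=; [exact: (reP u).2|exact: (imP u).2].
exists psi => u k uk; rewrite psiE /phi.
have Uk : U [set n | u (t n) = k] by exact: Uoo.
case: k uk Uk => ka kb uk Uk.
congr (Complex _ _); apply: cvg_lim => //; apply: cvg_near_cst;
  by apply: filterS Uk => n /= un; rewrite /re /im un.
Qed.

Lemma evaluation_functional (t : T) :
  exists phi : continuous_dual (Cb T C), forall u, sval phi u = u t.
Proof.
apply: (@continuous_dual_exists _ _ (Cb T C) (fun u => u t) 1) => // u.
by rewrite mul1r rnorm_Cb_ub.
Qed.

(** This reads off values at a weak cluster point; it holds because [phi] is weakly continuous and
    the scalars are Hausdorff. *)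
Lemma weak_cluster_functional (F : set_system (Cb T C)) (u : Cb T C) (k : C)
    (phi : continuous_dual (Cb T C)) :
  cluster (F : set_system (weak_space (Cb T C))) u ->
  F [set v | sval phi v = k] -> sval phi u = k.
Proof.
move=> clu Fk; apply: (@norm_hausdorff _ C) => A B Au Bk.
have [v [vk Av]] := clu _ _ Fk (weak_functional_continuous Au).
by exists (sval phi v); split=> //; rewrite vk; exact: nbhs_singleton.
Qed.

(* Grothendieck's double limit obstruction to weak relative compactness. *)
Lemma not_EAP_double_limit (g : Cb T C) (s t : nat -> T) :
  (forall m n, (m <= n)%N -> g (time_add (s n) (t m)) = 0) ->
  (forall m n, (n < m)%N -> g (time_add (s n) (t m)) = 1) ->
  ~ EAP g.
Proof.
move=> g0 g1 [B OB [cB _]].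
pose F := (fun n => translate (s n) g) @ \oo.
have [|h [_ clh]] := cB F _.
  by apply: (@filterE nat \oo) => n; apply: OB; exists (s n).
(* The cluster point [h] vanishes at each [t m], because the translates by [s n] do for [n >= m]; so
   [phi] is 0 at [h]. But [phi] is 1 at every translate, which equals 1 at [t m] for [m > n], and
   hence 1 at [h]. *)
have [phi phiE] := sequential_limit_functional t.
have h0 m : h (t m) = 0.
  have [ev evE] := evaluation_functional (t m); rewrite -evE.
  apply: weak_cluster_functional clh _.
  by exists m => // n /= mn; rewrite evE; exact: g0.
have : sval phi h = 0 by apply: phiE; exact: nearW.
have -> : sval phi h = 1.
  apply: weak_cluster_functional clh _.
  apply: (@filterE nat \oo) => n /=; apply: phiE.
  by exists n.+1 => // m /= nm; exact: g1.
by move/eqP; rewrite oner_eq0.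
Qed.

End double_limit.

(** * The 1-periodic bump and its Lipschitz bound *)

Section sine_bumps.
Variable R : realType.
Implicit Types (s t : R) (z : int).

Definition bump t : R := sin (pi * t) ^+ 2.

Lemma bump_ge0 t : 0 <= bump t.
Proof. exact: sqr_ge0. Qed.

Lemma bump_le1 t : bump t <= 1.
Proof. by rewrite /bump -(cos2Dsin2 (pi * t)) lerDr sqr_ge0. Qed.

Lemma bumpDn t (n : nat) : bump (t + n%:R) = bump t.
Proof.
elim: n => [|n IH]; first by rewrite addr0.
by rewrite -natr1 addrA /bump mulrDr mulr1 sinDpi sqrrN.
Qed.

Lemma bump_int z : bump z%:~R = 0.
Proof.
have b0 : bump 0 = 0 by rewrite /bump mulr0 sin0 expr0n.
case: z => n; first by rewrite -[_%:~R]add0r bumpDn.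
by rewrite NegzE -(bumpDn _ n.+1) mulrNz addNr.
Qed.

Lemma bump_half (n : nat) : bump (n%:R + 2^-1) = 1.
Proof. by rewrite addrC bumpDn /bump sin_pihalf expr1n. Qed.

Lemma is_derive_mulpi (f : R -> R) (a t : R) :
  is_derive (pi * t) 1 f a -> is_derive t 1 (fun x => f (pi * x)) (a * pi).
Proof.
move=> df; apply: (@is_derive1_comp _ f (fun x => pi * x)) df _.
have := @is_deriveZ _ _ _ id pi t 1 1 (is_derive_id _ _).
by rewrite /GRing.scale/= mulr1.
Qed.

Lemma is_derive_bump t :
  is_derive t 1 bump (2 * sin (pi * t) * (cos (pi * t) * pi)).
Proof.
have := is_deriveX 2 (is_derive_mulpi (is_derive_sin (pi * t))).
by rewrite /= expr1.
Qed.

Lemma bump_continuous : continuous bump.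
Proof.
move=> x; apply: differentiable_continuous; apply/derivable1_diffP.
exact: (@ex_derive _ _ _ _ _ _ _ (is_derive_bump x)).
Qed.

(** Mean value theorem, with sine and cosine each bounded by 1 in the derivative. *)
Lemma bump_lipschitz s t : `|bump s - bump t| <= 2 * pi * `|s - t|.
Proof.
wlog st : s t / s <= t.
  move=> st; have [/st//|/ltW/st] := leP s t.
  by rewrite distrC (distrC t).
have [x _ E] := MVT_segment st (fun x _ => is_derive_bump x)
  (continuous_subspaceT bump_continuous).
rewrite distrC E normrM (distrC s) ler_wpM2r//.
rewrite !normrM (ger0_norm (@pi_ge0 R)) ger0_norm//.
rewrite -!mulrA ler_wpM2l// mulrA ler_piMl ?pi_ge0//.
by rewrite mulr_ile1 ?sin_max ?cos_max.
Qed.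

End sine_bumps.

(** * Integrals of bumps and oscillating averages *)

Section averages.
Variable R : realType.
Local Notation mu := (@lebesgue_measure R).
Implicit Types (G : R -> R) (a b k t : R).

Lemma continuous_itv_integrable G a b : continuous G ->
  mu.-integrable `[a, b] (EFin \o G).
Proof.
move=> cG; apply: continuous_compact_integrable; first exact: segment_compact.
exact: continuous_subspaceT.
Qed.

Lemma Rintegral_itv_split G a b d : continuous G -> a <= b -> b <= d ->
  \int[mu]_(t in `[a, d]) G t =
  \int[mu]_(t in `[a, b]) G t + \int[mu]_(t in `[b, d]) G t.
Proof.
move=> cG ab bd.
have := @Rintegral_itvB _ G (BLeft a) (BRight d) b
  (continuous_itv_integrable _ _ cG).
rewrite !bnd_simp => /(_ ab bd).
rewrite Rintegral_itv_obnd_cbnd; first by move=> <-; rewrite addrC subrK.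
apply: integrableS (continuous_itv_integrable _ _ cG) => //.
by apply: subset_itvr; rewrite bnd_simp.
Qed.

(** The square of the sine has mean 1/2 over a period. The offset [k] serves the lower bound
    [x - 4^-1 <= p x] of [wave_no_mean]. *)
Lemma Rintegral_bumpB k (m n : nat) : (m < n)%N ->
  \int[mu]_(t in `[m%:R, n%:R]) (bump t - k) = (2^-1 - k) * (n%:R - m%:R).
Proof.
move=> mn; have pi0 : pi != 0 :> R by rewrite gt_eqF// pi_gt0.
(* An antiderivative of [bump t - k], whose trigonometric term vanishes at the integers. *)
pose W (t : R) := (2^-1 - k) * t - (2 * pi)^-1 * (sin (pi * t) * cos (pi * t)).
have fld (p x : R) : p != 0 ->
    (2^-1 - k) * 1 - (2 * p)^-1 * ((1 - 2 * x ^+ 2) * p) = x ^+ 2 - k.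
  by move=> p0; field.
have dW t : is_derive t 1 W (bump t - k).
  have dsc := is_deriveM (is_derive_mulpi (is_derive_sin (pi * t)))
    (is_derive_mulpi (is_derive_cos (pi * t))).
  have := is_deriveB (is_deriveZ (2^-1 - k) (is_derive_id t (1 : R)))
    (is_deriveZ (2 * pi)^-1 dsc).
  move=> /is_derive_eq; apply.
  rewrite /GRing.scale/= /bump.
  have := cos2Dsin2 (pi * t).
  set x := sin _; set y := cos _ => xy.
  have -> : x * (- x * pi) + y * (y * pi) = (1 - 2 * x ^+ 2) * pi.
    have -> : x * (- x * pi) + y * (y * pi) = (y ^+ 2 - x ^+ 2) * pi by ring.
    by rewrite (_ : y ^+ 2 = 1 - x ^+ 2); [ring|rewrite -xy addrK].
  exact: fld.
have sn (j : nat) : sin (pi * j%:R) = 0 :> R.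
  apply/eqP; rewrite -sqrf_eq0; apply/eqP; exact: (bump_int R j).
have cW t : {for t, continuous W}.
  by apply: differentiable_continuous; apply/derivable1_diffP;
    exact: (@ex_derive _ _ _ _ _ _ _ (dW t)).
rewrite /Rintegral (@continuous_FTC2 _ _ W).
- by rewrite -EFinB/= /W !sn !mul0r mulr0 !subr0 mulrBr.
- by rewrite ltr_nat.
- apply: continuous_subspaceT => t.
  by apply: cvgB; [exact: bump_continuous|exact: cvg_cst].
- split.
  + by move=> t _; exact: (@ex_derive _ _ _ _ _ _ _ (dW t)).
  + by apply: cvg_at_right_filter; exact: cW.
  + by apply: cvg_at_left_filter; exact: cW.
- by move=> t _; rewrite derive1E; exact: (@derive_val _ _ _ _ _ _ _ (dW t)).
Qed.

(* Writing A(T) for the average over [0, T], the two hypotheses on G give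
   A(2T) >= A(T)/2 + k/2 and A(4T) = A(2T)/2 at T = 4^n, hence a limit L of A
   would satisfy both L >= k and L = 0. *)
Lemma average_no_limit G k : 0 < k -> continuous G ->
  (forall (n : nat) t, 2 * 4 ^+ n <= t <= 4 ^+ n.+1 -> G t = 0) ->
  (forall n : nat, k * 4 ^+ n <= \int[mu]_(t in `[4 ^+ n, 2 * 4 ^+ n]) G t) ->
  ~ cvg (T^-1 * \int[mu]_(t in `[0, T]) G t @[T --> +oo]).
Proof.
move=> k0 cG G0 Gk cvA.
pose A T := T^-1 * \int[mu]_(t in `[0, T]) G t.
pose L := lim (A T @[T --> +oo]).
have AL : A T @[T --> +oo] --> L by exact: cvA.
have pow_gt0 n : 0 < (4 : R) ^+ n by rewrite exprn_gt0.
have pow_cvg : (4 : R) ^+ n @[n --> \oo] --> +oo.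
  apply/cvgryPge => M; near=> n.
  apply: (@le_trans _ _ n%:R); last first.
    by rewrite -natrX ler_nat ltnW// ltn_expl.
  by near: n; exact: nbhs_infty_ger.
have A1 : A (4 ^+ n) @[n --> \oo] --> L by apply: cvg_comp AL.
have A4 : A (4 ^+ n.+1) @[n --> \oo] --> L.
  by rewrite (cvg_shiftS (fun n => A (4 ^+ n))).
have A2 : A (2 * 4 ^+ n) @[n --> \oo] --> L.
  apply: cvg_comp AL; apply/cvgryPge => M.
  move/cvgryPge : pow_cvg => /(_ M); apply: filterS => n Mn.
  by rewrite (le_trans Mn)// ler_peMl ?ler1n// ltW.
have A4E n : A (4 ^+ n.+1) = 2^-1 * A (2 * 4 ^+ n).
  rewrite /A (@Rintegral_itv_split _ 0 (2 * 4 ^+ n))//.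
  - rewrite [X in _ + X](_ : _ = 0) ?addr0.
      rewrite exprS mulrA; congr (_ * _).
      by rewrite -invfM mulrA -natrM.
    rewrite (@eq_Rintegral _ _ _ _ _ (cst 0)).
      by rewrite Rintegral_cst// mul0r.
    by move=> t /set_mem/=; rewrite in_itv/= => /G0.
  - by rewrite exprS ler_pM2r// ler_nat.
have A2E n : 2^-1 * A (4 ^+ n) + 2^-1 * k <= A (2 * 4 ^+ n).
  rewrite /A (@Rintegral_itv_split _ 0 (4 ^+ n) (2 * 4 ^+ n))//.
  - rewrite invfM -[leRHS]mulrA (mulrDr (4 ^+ n)^-1) [leRHS]mulrDr lerD2l.
    by rewrite ler_pM2l ?invr_gt0// mulrC ler_pdivlMr.
  - by rewrite ler_peMl ?ler1n// ltW.
have L0 : L = 2^-1 * L.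
  have A4' : A (4 ^+ n.+1) @[n --> \oo] --> 2^-1 * L.
    by rewrite (funext A4E); apply: cvgMr.
  exact: cvg_unique A4 A4'.
have Lk : 2^-1 * L + 2^-1 * k <= L.
  have A1' : 2^-1 * A (4 ^+ n) + 2^-1 * k @[n --> \oo] --> 2^-1 * L + 2^-1 * k.
    by apply: cvgD; [exact: cvgMr|exact: cvg_cst].
  by apply: ler_cvg_to A1' A2 _; exact: nearW.
lra.
Unshelve. all: by end_near. Qed.

End averages.

(** * Reduction of the mean to the half line *)

Section means.
Variables (R : realType) (J : time_domain).
Local Notation mu := (@lebesgue_measure R).
Local Notation T := (time R J).

(** On the full line the integral over [[- S, 0]] vanishes, so the symmetric average is half the
    one-sided average; hence the limit [2 * l] in that case. *)
Lemma mean_exists_half_line (g : T -> R) (G : R -> R) :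
  (forall t : T, g t = G (set_val t)) -> continuous G ->
  (forall t, t <= 0 -> G t = 0) -> mean_exists g ->
  cvg (S^-1 * \int[mu]_(t in `[0, S]) G t @[S --> +oo]).
Proof.
case: J g => g gG cG G0 /cvg_ex[l avl]; apply/cvg_ex.
- exists l; apply: cvg_trans avl; apply: near_eq_cvg; near=> S.
  rewrite /average; congr (_ * _); apply: eq_Rintegral => t /set_mem/=.
  rewrite in_itv/= => /andP[t0 _].
  case: insubP => [u _ <-|]; first exact: gG.
  by rewrite mem_set//= in_itv/= t0.
- exists (2 * l).
  have avl2 : 2 * average g S @[S --> +oo] --> 2 * l by apply: cvgMr.
  apply: cvg_trans avl2.
  apply: near_eq_cvg; near=> S.
  have S0 : 0 <= S by near: S; exact: nbhs_pinfty_ge.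
  have -> : average g S = (2 * S)^-1 * \int[mu]_(t in `[- S, S]) G t.
    rewrite /average; congr (_ * _); apply: eq_Rintegral => t _.
    by case: insubP => [u _ <-|]; [exact: gG|rewrite mem_set].
  rewrite (@Rintegral_itv_split _ _ _ 0)//; last by rewrite oppr_le0.
  have -> : \int[mu]_(t in `[- S, 0]) G t = \int[mu]_(t in `[- S, 0]) cst 0 t.
    apply: eq_Rintegral => t /set_mem/=.
    by rewrite in_itv/= => /andP[_ /G0].
  by rewrite Rintegral_cst// mul0r add0r invfM !mulrA divff// mul1r.
Unshelve. all: by end_near. Qed.

End means.

Lemma time_ge0 (R : realType) (J : time_domain) (x : R) :
  0 <= x -> x \in time_set R J.
Proof. by move=> x0; apply/mem_set; case: J => //=; rewrite in_itv/= x0. Qed.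

(** * Blocks of integers and the gaps between them *)

Section blocks.
Variable R : realType.
Implicit Types (t : R) (z : int) (n : nat).

Definition in_block z : bool :=
  `[< exists n, (4 ^ n)%N%:Z <= z < (2 * 4 ^ n)%N%:Z >].

Lemma in_block_gt0 z : in_block z -> 0 < z.
Proof.
move=> /asboolP[n /andP[nz _]]; apply: lt_le_trans nz.
by rewrite ltz_nat expn_gt0.
Qed.

Lemma floor_in_block n t : 4 ^+ n <= t < 2 * 4 ^+ n -> in_block (Num.floor t).
Proof.
move=> /andP[nt tn]; apply/asboolP; exists n.
rewrite floor_ge_int floor_lt_int -!pmulrn natrM natrX nt.
by rewrite (lt_le_trans tn).
Qed.

Lemma floor_notin_block n t :
  2 * 4 ^+ n <= t < 4 ^+ n.+1 -> ~~ in_block (Num.floor t).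
Proof.
move=> /andP[nt tn]; apply/asboolP => -[m].
rewrite floor_ge_int floor_lt_int -!pmulrn natrM natrX => /andP[mt tm].
(* A block of index above [n] starts no earlier than [4 ^+ n.+1]; one of index at most [n] ends no
   later than [2 * 4 ^+ n]. *)
have [nm|mn] := ltnP n m.
  have le_nm : 4 ^+ n.+1 <= 4 ^+ m :> R by rewrite ler_weXn2l// ler1n.
  by rewrite ltNge (le_trans le_nm mt) in tn.
have le_mn : 2 * 4 ^+ m <= 2 * 4 ^+ n :> R.
  by rewrite ler_pM2l// ler_weXn2l// ler1n.
by rewrite ltNge (le_trans le_mn nt) in tm.
Qed.

Lemma floor_le0_notin_block t : t <= 0 -> ~~ in_block (Num.floor t).
Proof.
move=> t0; apply/negP => /in_block_gt0; rewrite floor_gt0 => t1.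
by have := le_lt_trans (le_trans t1 t0) ltr01; rewrite ltxx.
Qed.

End blocks.

(** * The wave, its translates and its norm *)

Section wave.
Variables (R : realType) (c : scalar_kind).
Local Notation K := (scalar_field R c).
Variables (H : normedModType K) (ip : {dot H for @scalar_conj R c}).
Hypothesis ip_norm : forall x : H, `|x| ^+ 2 = ip x x.
Variable e : nat -> H.
Hypothesis e1 : forall n, `|e n| = 1.
Hypothesis eo : forall m n, m != n -> ip (e m) (e n) = 0.
Implicit Types (s t : R) (z : int) (n : nat).

(** Blocks contain only positive integers, so passing to [|z|%N] is injective on them. *)
Definition block_vector z : H := if in_block z then e `|z|%N else 0.

Definition wave t : H := of_real c (bump t) *: block_vector (Num.floor t).

Lemma rnorm_block_vector z : rnorm (block_vector z) = (in_block z)%:R.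
Proof.
rewrite /block_vector; case: ifP => _; last exact: rnorm0.
by rewrite /rnorm e1 -(of_real1 R c) of_realK.
Qed.

Lemma rnormZ_real (a : R) (v : H) : rnorm (of_real c a *: v) = `|a| * rnorm v.
Proof. by rewrite rnormZ norm_of_real of_realK. Qed.

Lemma rnorm_wave t : rnorm (wave t) = bump t * (in_block (Num.floor t))%:R.
Proof. by rewrite rnormZ_real rnorm_block_vector ger0_norm ?bump_ge0. Qed.

Lemma rnorm_wave_on n t : 4 ^+ n <= t <= 2 * 4 ^+ n -> rnorm (wave t) = bump t.
Proof.
(* At the right endpoint the floor has left the block, but both sides vanish there with the bump. *)
move=> /andP[nt]; rewrite rnorm_wave le_eqVlt => /predU1P[->|tn].
  by rewrite -natrX -natrM (bump_int R (2 * 4 ^ n)%N) mul0r.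
by rewrite (@floor_in_block _ n) ?mulr1// nt.
Qed.

Lemma rnorm_wave_off n t : 2 * 4 ^+ n <= t <= 4 ^+ n.+1 -> rnorm (wave t) = 0.
Proof.
(* At [4 ^+ n.+1] the next block has begun, but the bump still vanishes. *)
move=> /andP[nt]; rewrite rnorm_wave le_eqVlt => /predU1P[->|tn].
  by rewrite -natrX (bump_int R (4 ^ n.+1)%N) mul0r.
by rewrite (negbTE (@floor_notin_block _ n _ _)) ?mulr0// nt.
Qed.

Lemma rnorm_wave_le0 t : t <= 0 -> rnorm (wave t) = 0.
Proof.
by move=> t0; rewrite rnorm_wave (negbTE (floor_le0_notin_block t0)) mulr0.
Qed.

Lemma rnorm_wave_le_bump t : rnorm (wave t) <= bump t.
Proof. by rewrite rnorm_wave ler_piMr ?bump_ge0// lern1 leq_b1. Qed.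

Lemma rnorm_wave_le1 t : rnorm (wave t) <= 1.
Proof. exact: le_trans (rnorm_wave_le_bump t) (bump_le1 t). Qed.

(** Points at distance at least 1 have different floors, so their directions are different members
    of [e], unless one of them is 0. *)
Lemma wave_orthogonal s t : 1 <= `|s - t| -> ip (wave s) (wave t) = 0.
Proof.
move=> st; rewrite /wave linearZl_LR/= linearZr_LR/=.
suff -> : ip (block_vector (Num.floor s)) (block_vector (Num.floor t)) = 0.
  by rewrite !mulr0.
rewrite /block_vector; case: ifP => [/in_block_gt0 s0|_]; last first.
  by rewrite linear0l.
case: ifP => [/in_block_gt0 t0|_]; last by rewrite linear0r.
apply: eo; apply/negP => /eqP fst.
have {}fst : Num.floor s = Num.floor t by lia.
have := floor_itv s; have := floor_itv t; rewrite fst intrD => ft fs.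
move: st; rewrite leNgt => /negP; apply; rewrite ltr_norml.
by lra.
Qed.

(* Where the direction jumps, at an integer, the bump vanishes. *)
Lemma wave_lipschitz s t : rnorm (wave s - wave t) <= 2 * pi * `|s - t|.
Proof.
wlog st : s t / s <= t.
  move=> hw; have [/hw//|/ltW/hw] := leP s t.
  by rewrite -rnormN opprB distrC.
have [E|neq] := eqVneq (Num.floor s) (Num.floor t).
  rewrite /wave E -scalerBl -of_realB rnormZ_real rnorm_block_vector.
  apply: le_trans (bump_lipschitz s t).
  by rewrite ler_piMr// lern1 leq_b1.
have fst : Num.floor s < Num.floor t by rewrite lt_neqAle neq le_floor.
(* The integer [z] lies in []s, t]], so its distances to [s] and [t] add up to [t - s]. *)
set z : R := (Num.floor t)%:~R.
have zt : z <= t by exact: floor_le.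
have sz : s < z by rewrite -floor_lt_int.
apply: le_trans (rnormD _ _) _; rewrite rnormN.
apply: (@le_trans _ _ (`|bump s - bump z| + `|bump t - bump z|)).
  rewrite bump_int !subr0 !ger0_norm ?bump_ge0//.
  by rewrite lerD// rnorm_wave_le_bump.
apply: le_trans (lerD (bump_lipschitz _ _) (bump_lipschitz _ _)) _.
rewrite -mulrDr ler_wpM2l ?mulr_ge0 ?pi_ge0//.
rewrite distrC (ger0_norm (_ : 0 <= z - s)) ?subr_ge0 ?(ltW sz)//.
rewrite (ger0_norm (_ : 0 <= t - z)) ?subr_ge0//.
by rewrite distrC ger0_norm ?subr_ge0//; lra.
Qed.

Lemma wave_continuous : continuous wave.
Proof.
move=> t; apply/cvgrPdist_le => eps eps0.
have eps0' := scalar_re_gt0 eps0.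
have pi2 : 0 < 2 * pi :> R by rewrite mulr_gt0// pi_gt0.
have /cvgrPdist_le/(_ (scalar_re eps / (2 * pi))) : id u @[u --> t] --> t.
  exact: cvg_id.
rewrite divr_gt0// => /(_ isT); apply: filterS => u /= tu.
rewrite -rnormE -{1}(scalar_reK (ltW eps0)) ler_of_real.
apply: le_trans (wave_lipschitz _ _) _.
by rewrite mulrC -ler_pdivlMr.
Qed.

Variable J : time_domain.
Local Notation T := (time R J).

Lemma wave_translateP s : (fun t : T => wave (set_val t + s)) \in is_Cb T H.
Proof.
apply/is_CbP; split; last by exists 1 => t; exact: rnorm_wave_le1.
move=> t; apply: (@continuous_comp _ R _ set_val (fun x => wave (x + s))).
  exact: (@initial_continuous _ R set_val).
apply: (@continuous_comp _ R _ (fun x => x + s) wave).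
  by apply: cvgD; [exact: cvg_id|exact: cvg_cst].
exact: wave_continuous.
Qed.

(** The shift runs over all reals even when [J] is the half line, so that one family indexed by [R]
    contains the orbit in both cases. *)
Definition wave_translate s : Cb T H := MkCb (wave_translateP s).

Lemma wave_translate_continuous : continuous wave_translate.
Proof.
move=> s; apply/cvgrPdist_le => eps eps0.
have eps0' := scalar_re_gt0 eps0.
have pi2 : 0 < 2 * pi :> R by rewrite mulr_gt0// pi_gt0.
have /cvgrPdist_le/(_ (scalar_re eps / (2 * pi))) : id u @[u --> s] --> s.
  exact: cvg_id.
rewrite divr_gt0// => /(_ isT); apply: filterS => u /= su.
rewrite -rnormE -{1}(scalar_reK (ltW eps0)) ler_of_real rnorm_Cb.
apply: sup_norm_le => [|t]; first exact: ltW.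
apply: le_trans (wave_lipschitz _ _) _.
by rewrite opprD addrACA subrr add0r mulrC -ler_pdivlMr.
Qed.

Lemma wave_translate_weakly_null (phi : continuous_dual (Cb T H)) (eps : R) :
  0 < eps -> exists M : R, forall s, M <= `|s| ->
    rnorm (sval phi (wave_translate s) : K^o) < eps.
Proof.
apply: (orthogonal_family_weakly_null ip_norm) => [s r t sr|s t].
  by apply: wave_orthogonal; rewrite opprD addrACA subrr add0r.
exact: rnorm_wave_le1.
Qed.

Lemma translate_wave (s : T) :
  translate s (wave_translate 0) = wave_translate (set_val s).
Proof.
by apply/val_inj/funext => t /=; rewrite addr0; congr wave; exact: addrC.
Qed.

Lemma wave_EAP0 : EAP0 (wave_translate 0).
Proof.
split.
  apply: precompact_subset (weakly_null_family_precompact ip_norm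
    wave_translate_continuous wave_translate_weakly_null).
  by move=> _ [s _ <-]; rewrite translate_wave; exists (set_val s).
(* Natural shifts are admissible in both time domains and suffice to reach 0 in the weak closure. *)
have null : wave_translate n%:R @[n --> \oo] --> (0 : weak_space (Cb T H)).
  apply: weak_cvg => phi; rewrite linear0; apply/cvgrPdist_lt => d d0.
  have [M MP] := wave_translate_weakly_null phi (scalar_re_gt0 d0).
  apply: (@filterS nat \oo _ _ _ _ (nbhs_infty_ger M)) => n /= Mn.
  rewrite sub0r normrN -rnormE -(scalar_reK (ltW d0)).
  by rewrite ltr_of_real; apply: MP; rewrite normr_nat.
move=> B B0; have [n _ nB] := null _ B0.
exists (wave_translate n%:R); split; last by apply: nB => /=.
by exists (SigSub (time_ge0 J (ler0n R n))) => //; rewrite translate_wave.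
Qed.

(* Both [p x = x] and [p x = x ^+ 2] satisfy the hypotheses on [p]. *)
Lemma wave_no_mean (p : R -> R) : continuous p -> p 0 = 0 ->
  (forall x, x - 4^-1 <= p x) ->
  ~ mean_exists (fun t : T => p (rnorm (wave_translate 0 t))).
Proof.
move=> cp p0 pge mean.
have cG : continuous (fun t => p (rnorm (wave t))).
  move=> t; apply: (@continuous_comp _ _ _ wave (fun v => p (rnorm v))).
    exact: wave_continuous.
  by apply: continuous_comp; [exact: rnorm_continuous|exact: cp].
have : cvg (S^-1 * \int[lebesgue_measure]_(t in `[0, S]) p (rnorm (wave t))
    @[S --> +oo]).
  apply: (mean_exists_half_line _ cG _ mean) => [t|t t0] /=.
    by rewrite addr0.
  by rewrite rnorm_wave_le0.
apply: (@average_no_limit _ _ 4^-1) => // [n t nt|n].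
  by rewrite (rnorm_wave_off nt).
have n4 : (4 ^ n < 2 * 4 ^ n)%N by rewrite ltn_Pmull// expn_gt0.
(* Over a block of length [4 ^ n] the function [bump - 4^-1] has mean [2^-1 - 4^-1 = 4^-1]. The
   offset is the maximum of [x - x ^+ 2], so the bound on [p] also covers the square. *)
have E : (2^-1 - 4^-1) * ((2 * 4 ^ n)%N%:R - (4 ^ n)%N%:R) = 4^-1 * 4 ^+ n :> R.
  by rewrite natrM natrX; field.
rewrite -E -(Rintegral_bumpB _ n4) natrM natrX.
apply: le_Rintegral => //.
- apply: continuous_itv_integrable => x.
  by apply: cvgB; [exact: bump_continuous|exact: cvg_cst].
- exact: continuous_itv_integrable.
by move=> t; rewrite /= in_itv/= => nt; rewrite (rnorm_wave_on nt).
Qed.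

Lemma wave_not_EAP (p : R -> R)
    (g : Cb T ((scalar_field R ComplexScalars)^o)) :
  (forall t : T,
    g t = of_real ComplexScalars (p (rnorm (wave_translate 0 t)))) ->
  p 0 = 0 -> p 1 = 1 -> ~ EAP g.
Proof.
move=> gp p0 p1.
have s0 n : 0 <= 2 * 4 ^+ n :> R by rewrite mulr_ge0// exprn_ge0.
have t0 n : 0 <= 4 ^+ n + 2^-1 :> R by rewrite addr_ge0 ?exprn_ge0// invr_ge0.
pose s n : T := SigSub (time_ge0 J (s0 n)).
pose t n : T := SigSub (time_ge0 J (t0 n)).
have pow1 n : 1 <= 4 ^+ n :> R by rewrite exprn_ege1// ler1n.
have powle m n : (m <= n)%N -> 4 ^+ m <= 4 ^+ n :> R.
  by move=> mn; rewrite ler_weXn2l// ler1n.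
have stE n m : set_val (time_add (s n) (t m)) = 2 * 4 ^+ n + (4 ^+ m + 2^-1).
  by [].
apply: (@not_EAP_double_limit _ _ g s t) => m n mn; rewrite gp /= addr0.
  (* For [m <= n] the point is at most [3 * 4 ^+ n + 2^-1], hence in the gap following block [n]. *)
  rewrite (stE n m) (@rnorm_wave_off n) ?p0 ?of_real0//.
  have := pow1 n; have := pow1 m; have := powle _ _ mn; rewrite exprS.
  lra.
(* For [n < m] the shift [2 * 4 ^+ n] is at most half of [4 ^+ m], so the point is a half-integer of
   block [m], where the bump is 1. *)
rewrite (stE n m) (@rnorm_wave_on m).
  rewrite addrA -natrX -natrX -natrM -natrD bump_half p1.
  exact: (of_real1 R ComplexScalars).
have := pow1 n; have := pow1 m; have := powle _ _ mn; rewrite exprS.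
lra.
Qed.

End wave.

Theorem mainTheorem1 (R : realType) (J : time_domain) (c : scalar_kind)
    (H : completeNormedModType (scalar_field R c))
    (ip : {dot H for @scalar_conj R c})
    (ip_norm : forall x : H, `|x| ^+ 2 = ip x x)
    (H_inf : infinite_dimensional H) :
  exists f : Cb (time R J) H,
    [/\ EAP0 f,
        ~ mean_exists (norm_fun f),
        ~ mean_exists (sqnorm_fun f),
        ~ EAP (norm_Cb f) &
        ~ EAP (sqnorm_Cb f)].
Proof.
have [e [e1 eo]] := orthonormal_sequence ip_norm H_inf.
exists (wave_translate e1 J 0); split.
- exact: wave_EAP0.
- apply: (@wave_no_mean _ _ _ _ e1 J id) => // x; first exact: cvg_id.
  by rewrite gerBl invr_ge0.
- apply: (@wave_no_mean _ _ _ _ e1 J (fun x => x ^+ 2)) => [x||x].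
  + exact: exprn_continuous.
  + by rewrite expr0n.
  + by rewrite -subr_ge0; have := sqr_ge0 (x - 2^-1); lra.
- exact: (@wave_not_EAP _ _ _ _ e1 J id).
- apply: (@wave_not_EAP _ _ _ _ e1 J (fun x => x ^+ 2)) => //.
  + by rewrite expr0n.
  + by rewrite expr1n.
Qed.
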